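(* Consider a finite game with agent set $\mathcal{N}=\{1,\dots,n\}$, finite action sets $\mathcal{X}_i$, joint action space $\mathcal{X}=\prod_{i\in\mathcal{N}}\mathcal{X}_i$, nominal deviation costs $\Delta\bar J_i(x_i,x_i',x_{-i})\in\mathbb{R}$, and agent-level real random perturbations $\eta_i\sim\nu_i$, $i\in\mathcal{N}$. Let $\alpha\in(0,1)$. For $x\in\mathcal{X}$ let $\delta_x\in\Delta(\mathcal{X})$ denote the distribution placing all its mass on $x$. Then $$\operatorname{conv}\{\delta_x : x\in\mathcal{X}\text{ is a chance-constrained pure Nash equilibrium with confidence level }\alpha\}$$ is a subset of the set of all chance-constrained correlated equilibria $z\in\Delta(\mathcal{X})$ with confidence level $\alpha$.
   Context: Setting: $\mathcal{N}=\{1,\dots,n\}$ is a finite set of agents; each agent $i$ has a finite action set $\mathcal{X}_i$; $\mathcal{X}=\prod_{i}\mathcal{X}_i$; $x_{-i}\in\prod_{j\ne i}\mathcal{X}_j$ denotes the actions of all agents except $i$; $\Delta(\mathcal{X})$ is the set of probability distributions on $\mathcal{X}$; $\operatorname{conv}$ denotes the convex hull. Uncertainty model: for each agent $i$, all $x_i,x_i'\in\mathcal{X}_i$ and all $x_{-i}$, the true deviation cost (cost of playing $x_i$ minus cost of playing $x_i'$, given that the others play $x_{-i}$) is $$\Delta J_i(x_i,x_i',x_{-i})=\Delta\bar J_i(x_i,x_i',x_{-i})+\eta_i,$$ where $\Delta\bar J_i(x_i,x_i',x_{-i})\in\mathbb{R}$ is a given deterministic nominal estimate and $\eta_i$ is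 a real random variable with distribution $\nu_i$. The same $\eta_i$ is common to all deviation comparisons of agent $i$ (it does not depend on the action profile). $\mathbb{P}_{\nu_i}$ denotes probability with respect to $\eta_i\sim\nu_i$. Chance-constrained correlated equilibrium (CC-CE) with confidence level $\alpha\in(0,1)$: a distribution $z\in\Delta(\mathcal{X})$ such that $$\mathbb{P}_{\nu_i}\left(\mathbb{E}_{x_{-i}\sim z(\cdot\mid x_i)}\left[\Delta\bar J_i(x_i,x_i',x_{-i})\right]+\eta_i\le 0\right)\ge\alpha$$ for all $i\in\mathcal{N}$, all $x_i\in\mathcal{X}_i$, and all $x_i'\in\mathcal{X}_i$ with $x_i'\neq x_i$. Here $z(\cdot\mid x_i)$ is the conditional distribution of $x_{-i}$ given that agent $i$'s component is $x_i$; the condition is imposed only for those $x_i$ that have positive marginal probability under $z$ (otherwise it is vacuous). Chance-constrained pure Nash equilibrium (CC-PNE) with confidence level $\alpha$: a profile $x\in\mathcal{X}$ such that $$\mathbb{P}_{\nu_i}\left(\Delta J_i(x_i,x_i',x_{-i})\le 0\right)\ge\alpha\quad\text{for all } i\in\mathcal{N}\text{ and all }x_i'\in\mathcal{X}_i,\ x_i'\ne x_i,$$ where $\Delta J_i(x_i,x_i',x_{-i})=\Delta\bar J_i(x_i,x_i',x_{-i})+\eta_i$ is the true deviation cost, with $\Delta\bar J_i(x_i,x_i',x_{-i})\in\mathbb{R}$ the deterministic nominal estimate and $\eta_i\sim\nu_i$ the random perturbation of agent $i$. *)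

(* Defs.v *)
From HB Require Import structures.
From mathcomp Require Import all_boot all_order all_algebra.
From mathcomp Require Import all_classical all_reals all_analysis.

Set Implicit Arguments.
Unset Strict Implicit.
Unset Printing Implicit Defensive.

Import Order.TTheory GRing.Theory Num.Theory.
Local Open Scope classical_set_scope.
Local Open Scope ring_scope.

Definition profile (n : nat) (X : 'I_n -> finType) :=
  {dffun forall i : 'I_n, X i}.

Definition opp_profile (n : nat) (X : 'I_n -> finType) (i : 'I_n) :=
  {dffun forall j : {j : 'I_n | j != i}, X (val j)}.

Definition opponents (n : nat) (X : 'I_n -> finType) (i : 'I_n) (x : profile X) :
    opp_profile X i :=
  [ffun j : {j : 'I_n | j != i} => x (val j)].

Definition simplex (R : realType) (T : finType) : set {ffun T -> R} :=
  [set z | (forall t, 0 <= z t) /\ \sum_t z t = 1].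

Definition point_mass (R : realType) (T : finType) (t : T) : {ffun T -> R} :=
  [ffun s => (s == t)%:R].

Definition conv_hull (R : realType) (V : lmodType R) (A : set V) : set V :=
  [set v | exists (m : nat) (w : 'I_m -> R) (p : 'I_m -> V),
    [/\ forall k, 0 <= w k, \sum_k w k = 1, forall k, A (p k)
      & v = \sum_k w k *: p k]].

Definition marginal (R : realType) (n : nat) (X : 'I_n -> finType)
    (z : {ffun profile X -> R}) (i : 'I_n) (a : X i) : R :=
  \sum_(x : profile X | x i == a) z x.

(* Exactly one profile x satisfies x i = a and opponents i x = o, so the numerator
   is the mass z(a, o). When the marginal of a vanishes, the quotient is 0 and is
   not a distribution. *)
Definition conditional (R : realType) (n : nat) (X : 'I_n -> finType)
    (z : {ffun profile X -> R}) (i : 'I_n) (a : X i) :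
    {ffun opp_profile X i -> R} :=
  [ffun o => (\sum_(x : profile X | (x i == a) && (opponents i x == o)) z x)
             / marginal z a].

Definition expectation_under (R : realType) (T : finType)
    (q : {ffun T -> R}) (f : T -> R) : R :=
  \sum_t q t * f t.

(* dJ i a b o is the nominal cost of playing a minus that of playing b for
   agent i against o; e is the realisation of the agent's perturbation. *)
Definition true_deviation (R : realType) (n : nat) (X : 'I_n -> finType)
    (dJ : forall i : 'I_n, X i -> X i -> opp_profile X i -> R)
    (i : 'I_n) (a b : X i) (o : opp_profile X i) (e : R) : R :=
  dJ i a b o + e.

Definition cc_pne (R : realType) (n : nat) (X : 'I_n -> finType)
    (dJ : forall i : 'I_n, X i -> X i -> opp_profile X i -> R)
    (nu : 'I_n -> probability (measurableTypeR R) R) (alpha : R) :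
    set (profile X) :=
  [set x : profile X | forall (i : 'I_n) (b : X i), b != x i ->
    (alpha%:E <= nu i [set e | true_deviation dJ (x i) b (opponents i x) e <= 0]%R)%E].

Definition cc_ce (R : realType) (n : nat) (X : 'I_n -> finType)
    (dJ : forall i : 'I_n, X i -> X i -> opp_profile X i -> R)
    (nu : 'I_n -> probability (measurableTypeR R) R) (alpha : R) :
    set {ffun profile X -> R} :=
  [set z : {ffun profile X -> R} | simplex z /\
    forall (i : 'I_n) (a b : X i), 0 < marginal z a -> b != a ->
      (alpha%:E <=
       nu i [set e | expectation_under (conditional z a) (dJ i a b) + e <= 0]%R)%E].

(* Main.v *)
(** The event "the perturbed cost [c + eta] is nonpositive" grows as [c]
    decreases. Every profile charged by a mixture [z] of point masses at CC-PNEs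
    is itself a CC-PNE, and the conditional expected deviation cost given [x_i = a]
    is a weighted mean of the costs at charged profiles with [x_i = a], so it is at most
    the cost at one of these. The chance constraint there gives the one for [z].
    The perturbation being common to all profiles is what makes this
    comparison of events possible. *)

Require Import Defs.
From mathcomp Require Import all_boot all_order all_algebra.
From mathcomp Require Import all_classical all_reals all_analysis.

Set Implicit Arguments.
Unset Strict Implicit.
Unset Printing Implicit Defensive.

Import Order.TTheory GRing.Theory Num.Theory.
Local Open Scope classical_set_scope.
Local Open Scope ring_scope.

(** A maximizer of [f] over the indices of nonzero weight works. Asking for [w t != 0] places the
    witness in the support of [z] when [w] is [z]. *)
Lemma exists_ge_weighted_mean (R : realFieldType) (T : finType) (P : pred T)
    (w f : T -> R) :
  (forall t, 0 <= w t) -> 0 < \sum_(t | P t) w t ->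
  exists t, [/\ P t, w t != 0
    & (\sum_(s | P s) w s * f s) / (\sum_(s | P s) w s) <= f t].
Proof.
move=> w0 W0.
have [t0 /andP[Pt0 wt0]] : exists t, P t && (w t != 0).
  apply: contrapT => noQ; move: W0; rewrite big1 ?ltxx// => t Pt.
  by apply/eqP/negPn/negP => wt; apply: noQ; exists t; rewrite Pt.
have Qt0 : P t0 && (w t0 != 0) by rewrite Pt0.
case: (@Order.TotalTheory.arg_maxP _ _ _ t0 (fun t => P t && (w t != 0)) f Qt0)
  => t /andP[Pt wt] tmax.
exists t; split => //; rewrite ler_pdivrMr// mulrC mulr_suml.
(* [tmax] bounds [f s] only where [w s != 0]; the other terms vanish on both sides. *)
apply: ler_sum => s Ps; have [->|ws] := eqVneq (w s) 0; first by rewrite !mul0r.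
by apply: ler_wpM2l => //; apply: tmax; rewrite Ps.
Qed.

(** Grouping profiles by their opponents' part turns the mean over opponents into one over profiles,
    where the support of [z] is known. *)
Lemma expectation_conditionalE (R : realType) (n : nat) (X : 'I_n -> finType)
    (z : {ffun profile X -> R}) (i : 'I_n) (a : X i) (f : opp_profile X i -> R) :
  expectation_under (conditional z a) f =
  (\sum_(x : profile X | x i == a) z x * f (opponents i x)) / marginal z a.
Proof.
rewrite /expectation_under.
rewrite (partition_big (fun x : profile X => opponents i x) xpredT)//= mulr_suml.
apply: eq_bigr => o _; rewrite ffunE mulrAC; congr (_ / _).
by rewrite mulr_suml; apply: eq_bigr => x /andP[_ /eqP ->].
Qed.

Lemma conv_hull_simplex (R : realType) (T : finType) (A : set {ffun T -> R}) :
  A `<=` @simplex R T -> conv_hull A `<=` @simplex R T.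
Proof.
move=> AS z [m [w [p [w0 w1 Ap ->]]]]; split => [t|].
  rewrite sum_ffunE; apply: sumr_ge0 => k _; rewrite ffunE.
  by apply: mulr_ge0 => //; have [/(_ t)] := AS _ (Ap k).
under eq_bigr do rewrite sum_ffunE.
rewrite exchange_big/= -w1; apply: eq_bigr => k _.
under eq_bigr do rewrite ffunE.
by rewrite -mulr_sumr; have [_ ->] := AS _ (Ap k); rewrite mulr1.
Qed.

Lemma point_mass_simplex (R : realType) (T : finType) (t : T) :
  simplex (point_mass R t).
Proof.
split => [s|]; first by rewrite ffunE ler0n.
rewrite (bigD1 t)//= ffunE eqxx big1 ?addr0// => s /negbTE st.
by rewrite ffunE st.
Qed.

Lemma conv_hull_point_mass_support (R : realType) (T : finType) (A : set T)
    (z : {ffun T -> R}) (t : T) :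
  conv_hull [set point_mass R x | x in A] z -> z t != 0 -> A t.
Proof.
move=> [m [w [p [_ _ Ap ->]]]] zt; apply: contrapT => nAt; move/eqP: zt; apply.
rewrite sum_ffunE big1// => k _; rewrite ffunE.
have [x Ax <-] := Ap k; rewrite ffunE; case: eqP => [tx|_]; last exact: mulr0.
by case: nAt; rewrite tx.
Qed.

(** Both events are closed lower half-lines, hence measurable, and the one for [d] lies inside the
    one for [c]. *)
Lemma le_prob_shift_le0 (R : realType) (mu : probability (measurableTypeR R) R)
    (c d : R) : c <= d ->
  (mu [set e | d + e <= 0]%R <= mu [set e | c + e <= 0]%R)%E.
Proof.
move=> cd.
have mle (b : R) : measurable [set e : measurableTypeR R | b + e <= 0].
  rewrite (_ : [set e | _] = `]-oo, (- b)]%classic); first exact: measurable_itv.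
  by apply/seteqP; split => e /=; rewrite in_itv/= -(subr_le0 (- b)) opprK (addrC e).
by apply: le_measure; rewrite ?inE// => e /=; apply: le_trans; rewrite lerD2r.
Qed.

Theorem theorem1 (R : realType) (n : nat) (X : 'I_n -> finType)
    (dJ : forall i : 'I_n, X i -> X i -> opp_profile X i -> R)
    (nu : 'I_n -> probability (measurableTypeR R) R)
    (alpha : R) (halpha0 : 0 < alpha) (halpha1 : alpha < 1) :
  conv_hull [set @point_mass R (profile X) x | x in cc_pne dJ nu alpha]
    `<=` cc_ce dJ nu alpha.
Proof.
move=> z zconv.
have zsimplex : simplex z.
  by apply: conv_hull_simplex zconv => _ [x _ <-]; exact: point_mass_simplex.
split => // i a b za ba.
have [z0 _] := zsimplex.
(* [za] gives the positive total weight, as [marginal z a] unfolds to that sum. *)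
have [x [/eqP xa zx meanle]] :=
  exists_ge_weighted_mean (fun x => dJ i a b (opponents i x)) z0 za.
have := conv_hull_point_mass_support zconv zx => /(_ i b).
rewrite xa => /(_ ba) /le_trans; apply.
by apply: le_prob_shift_le0; rewrite expectation_conditionalE.
Qed.
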